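(* Let $m\ge 1$ and let $G^c=(V,E)$ be the cocktail party graph on $2m$ vertices, i.e. the graph obtained from the complete graph $K_{2m}$ by deleting the edges of a perfect matching. For every coloring of $E$ with two colors $1,2$ (giving spanning subgraphs $G^c_1=(V,E_1)$ and $G^c_2=(V,E_2)$, where $E=E_1\cup E_2$, $E_1\cap E_2=\emptyset$), there exist $A,B\subseteq V$ and colors $i,j\in\{1,2\}$ such that $A\cup B=V$, $A$ is a 2-reachable subset of $G^c_i$, and $B$ is a 2-reachable subset of $G^c_j$.
   Context: A subset $X$ of the vertex set of a graph $H$ is a 2-reachable subset of $H$ if any two vertices of $X$ are at distance at most two in $H$ (the connecting path may use vertices outside $X$). Here $G^c_i$ denotes the spanning subgraph of $G^c$ consisting of all edges of color $i$. *)

(* Defs.v *)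
From mathcomp Require Export all_boot.
Set Implicit Arguments.
Unset Strict Implicit.
Unset Printing Implicit Defensive.

(* A simple graph on V is given by its edge set E : {set {set V}}, all of whose
   members are 2-element subsets of V; every graph below is a spanning subgraph
   of the complete graph on V. *)

Definition complete_graph (V : finType) : {set {set V}} :=
  [set f : {set V} | #|f| == 2].

Definition adjacent (V : finType) (E : {set {set V}}) : rel V :=
  fun x y => [set x; y] \in E.

Definition perfect_matching (V : finType) (E M : {set {set V}}) : Prop :=
  M \subset E /\ partition M [set: V].

Definition cocktail_party (m : nat) (V : finType) (E : {set {set V}}) : Prop :=
  #|V| = 2 * m /\
  exists M : {set {set V}},
    perfect_matching (complete_graph V) M /\ E = complete_graph V :\: M.

(* Only the values of the colouring c on members of E matter. *)
Definition color_subgraph (V : finType) (k : nat) (E : {set {set V}})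
    (c : {set V} -> 'I_k) (i : 'I_k) : {set {set V}} :=
  [set f in E | c f == i].

(* Some path from x to y has at most d edges: p lists the vertices of the path
   after x, so that size p is its length (p = [::] when x = y). *)
Definition distance_le (V : finType) (E : {set {set V}}) (d : nat) (x y : V) :
    Prop :=
  exists p : seq V,
    [/\ path (adjacent E) x p, last x p = y, uniq (x :: p) & size p <= d].

Definition two_reachable (V : finType) (E : {set {set V}}) (X : {set V}) : Prop :=
  forall x y : V, x \in X -> y \in X -> distance_le E 2 x y.

(* Main.v *)
Require Import Defs.
From mathcomp Require Import all_boot.

Set Implicit Arguments.
Unset Strict Implicit.
Unset Printing Implicit Defensive.

(** Write [v'] for the partner of [v], and call the colours red and blue.  The
    closed red and blue neighbourhoods of [v] cover everything but [v'], so if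
    [v'] can be added to one of them we are done.  We are also done if no vertex
    is blue (or none is red) to both [v] and [v'].  Otherwise the obstruction is
    a matched pair [u], [u'] with [u] red to [v] and blue to [v'], [u'] blue to
    [v] and red to [v'], such that [u] has no red neighbour among the red
    neighbours of [v'] and [u'] has no blue neighbour among the blue neighbours
    of [v'].  Exchanging [v] and [v'] gives a similar pair [x], [x'].
    If [u] is the only vertex red to [v] and blue to [v'], the closed blue
    neighbourhoods of [u] and [v] cover.  Otherwise [x != u'], and one can take
    the red neighbourhood of [u'] together with the set made of [u], [v], [v']
    and the red neighbours of [v'] other than [u']: all these but [v] are blue
    to [u], and [v] reaches them in blue, through [x] where needed. *)

(** Walks of length at most two replace simple paths. Being Boolean, the relation lets a far vertex
    be extracted when it fails on a neighbourhood. *)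
Definition within2 (V : finType) (e : rel V) : rel V :=
  fun x y => [|| x == y, e x y | [exists z, e x z && e z y]].

Definition pairwise_within2 (V : finType) (e : rel V) (X : {set V}) : Prop :=
  {in X &, forall x y, within2 e x y}.

Definition closed_nbhd (V : finType) (e : rel V) (x : V) : {set V} :=
  [set y | (y == x) || e x y].

Record two_coloring (V : finType) (p : V -> V) (r b : rel V) : Prop := {
  partnerK : involutive p;
  red_sym : symmetric r;
  blue_sym : symmetric b;
  red_irr : irreflexive r;
  blue_irr : irreflexive b;
  not_red_blue : forall x y, r x y -> b x y -> False;
  red_or_blue : forall x y, x <> y -> y <> p x -> r x y \/ b x y
}.

Definition coverable (V : finType) (r b : rel V) : Prop :=
  exists (A B : {set V}) (s t : bool),
    [/\ forall x, x \in A \/ x \in B,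
        pairwise_within2 (if s then r else b) A
      & pairwise_within2 (if t then r else b) B].

(** * Sets whose points are pairwise at distance at most two *)

Lemma within2_refl (V : finType) (e : rel V) x : within2 e x x.
Proof. by rewrite /within2 eqxx. Qed.

Lemma within2_edge (V : finType) (e : rel V) x y : e x y -> within2 e x y.
Proof. by rewrite /within2 => ->; rewrite orbT. Qed.

Lemma within2_trans (V : finType) (e : rel V) z x y :
  e x z -> e z y -> within2 e x y.
Proof.
by move=> xz zy; apply/or3P/Or33/existsP; exists z; rewrite xz.
Qed.

Lemma within2_sym (V : finType) (e : rel V) :
  symmetric e -> symmetric (within2 e).
Proof.
move=> es x y; rewrite /within2 eq_sym es; congr [|| _, _ | _].
by apply: eq_existsb => z; rewrite es andbC es.
Qed.

Lemma pairwise_closed_nbhd (V : finType) (e : rel V) x :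
  symmetric e -> pairwise_within2 e (closed_nbhd e x).
Proof.
move=> es y z; rewrite !inE => /orP[/eqP->|xy] /orP[/eqP->|xz].
- exact: within2_refl.
- exact: within2_edge.
- by apply: within2_edge; rewrite es.
- by apply: (within2_trans (z := x)) => //; rewrite es.
Qed.

Lemma pairwise_within2U1 (V : finType) (e : rel V) x (X : {set V}) :
  symmetric e -> pairwise_within2 e X -> {in X, forall y, within2 e x y} ->
  pairwise_within2 e (x |: X).
Proof.
move=> es eX xX y z; rewrite !inE => /orP[/eqP->|yX] /orP[/eqP->|zX].
- exact: within2_refl.
- exact: xX.
- by rewrite within2_sym //; apply: xX.
- exact: eX.
Qed.

Lemma pairwise_within2S (V : finType) (e : rel V) (X Y : {set V}) :
  X \subset Y -> pairwise_within2 e Y -> pairwise_within2 e X.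
Proof. by move=> /subsetP sXY eY x y /sXY xY /sXY; apply: eY. Qed.

(** * Covers built around one matched pair *)

Lemma two_coloringC (V : finType) (p : V -> V) (r b : rel V) :
  two_coloring p r b -> two_coloring p b r.
Proof.
case=> pK rs bs ri bi rb rVb; split=> // x y; first by move=> bxy /rb; apply.
by move=> xy xpy; case: (rVb x y xy xpy); [right | left].
Qed.

Lemma coverableC (V : finType) (r b : rel V) : coverable b r -> coverable r b.
Proof.
case=> A [B [s [t [AB HA HB]]]]; exists A, B, (~~ s), (~~ t).
by split=> //; rewrite if_neg.
Qed.

(** A vertex outside both closed red neighbourhoods would be blue to [v] and to [p v]. *)
Lemma coverable_no_common_blue (V : finType) (p : V -> V) (r b : rel V) v :
  two_coloring p r b -> (forall z, b v z -> b (p v) z -> False) ->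
  coverable r b.
Proof.
move=> tc nbb; exists (closed_nbhd r v), (closed_nbhd r (p v)), true, true.
split; last 2 first; try exact: pairwise_closed_nbhd (red_sym tc).
move=> z; rewrite !inE.
case: (eqVneq z v) => [|/eqP zv]; first by left.
case: (eqVneq z (p v)) => [|/eqP zpv]; first by right.
have [->|bvz] := red_or_blue tc (not_eq_sym zv) zpv; first by left.
case: (red_or_blue tc (x := p v) (y := z)) => [|||bpz].
- exact: not_eq_sym.
- by rewrite (partnerK tc).
- by move->; right.
- by case: (nbb z).
Qed.

(** The two closed neighbourhoods of [v] miss at most [p v], so only a vertex [u] far from [p v] can
    prevent adding [p v] to the red one. *)
Lemma coverable_or_far (V : finType) (p : V -> V) (r b : rel V) v :
  two_coloring p r b ->
  coverable r b \/ exists2 u, u \in closed_nbhd r v & ~~ within2 r (p v) u.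
Proof.
move=> tc.
case: (boolP [forall u in closed_nbhd r v, within2 r (p v) u]); last first.
  by case/forall_inPn=> u *; right; exists u.
move/forall_inP=> near; left.
exists (p v |: closed_nbhd r v), (closed_nbhd b v), true, false; split.
- move=> z; rewrite !inE.
  case: (eqVneq z (p v)) => [|/eqP zpv]; first by left.
  case: (eqVneq z v) => [|/eqP zv]; first by left.
  by have [->|->] := red_or_blue tc (not_eq_sym zv) zpv; [left | right].
- apply: pairwise_within2U1 near; first exact: red_sym tc.
  exact: pairwise_closed_nbhd (red_sym tc).
- exact: pairwise_closed_nbhd (blue_sym tc).
Qed.

(** The common red neighbour [w] puts [v] within two red steps of [p v], so the far vertex [u] is
    not [v]. Nor is it [p v] or red to [p v], which leaves blue. *)
Lemma far_red (V : finType) (p : V -> V) (r b : rel V) v u w :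
  two_coloring p r b -> r v w -> r (p v) w ->
  u \in closed_nbhd r v -> ~~ within2 r (p v) u ->
  [/\ r v u, b (p v) u & forall z, r (p v) z -> ~ r u z].
Proof.
move=> tc rvw rpw; rewrite inE => uv far.
have nuv : u <> v.
  move=> E; case/negP: far; rewrite E.
  by apply: (within2_trans (z := w)) => //; rewrite (red_sym tc).
have rvu : r v u by case/orP: uv => // /eqP.
split=> //.
- case: (red_or_blue tc (x := p v) (y := u)) => //.
  + by move=> E; case/negP: far; rewrite E within2_refl.
  + by rewrite (partnerK tc).
  + by move=> rpu; case/negP: far; apply: within2_edge.
- move=> z rpz ruz; case/negP: far; apply: (within2_trans (z := z)) => //.
  by rewrite (red_sym tc).
Qed.

(** Each colour yields a far vertex, [u] for red and [w] for blue. The pair [u], [w] cannot be red,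
    since [w] is red to [p v], nor blue, since [u] is blue to [p v]; hence they are partners. *)
Lemma coverable_or_obstruction (V : finType) (p : V -> V) (r b : rel V) v w1 w2 :
  two_coloring p r b -> r v w1 -> r (p v) w1 -> b v w2 -> b (p v) w2 ->
  coverable r b \/
  exists u, [/\ r v u, b (p v) u, forall z, r (p v) z -> ~ r u z,
                b v (p u) & r (p v) (p u) /\ forall z, b (p v) z -> ~ b (p u) z].
Proof.
move=> tc r1 r1' b2 b2'; have tc' := two_coloringC tc.
case: (coverable_or_far v tc) => [|[u uv uf]]; first by left.
case: (coverable_or_far v tc') => [/coverableC|[w wv wf]]; first by left.
have [rvu bpu nru] := far_red tc r1 r1' uv uf.
have [bvw rpw nbw] := far_red tc' b2 b2' wv wf.
have Ew : w = p u.
  apply/eqP; case: eqP => // /(red_or_blue tc (x := u)) rVb.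
  case: rVb => [E||buw]; first by subst w; case: (not_red_blue tc rvu).
    by move/nru: rpw.
  by case: (nbw u) => //; rewrite (blue_sym tc).
by subst w; right; exists u.
Qed.

Lemma two_coloring_coverable (V : finType) (p : V -> V) (r b : rel V) (v : V) :
  two_coloring p r b -> coverable r b.
Proof.
move=> tc; have tc' := two_coloringC tc.
case: (boolP [exists z, r v z && r (p v) z]) => [|nrr]; last first.
  apply/coverableC/(coverable_no_common_blue (v := v) tc') => z vz pz.
  by case/existsP: nrr; exists z; rewrite vz.
case/existsP=> w1 /andP[r1 r1'].
case: (boolP [exists z, b v z && b (p v) z]) => [|nbb]; last first.
  apply: (coverable_no_common_blue (v := v) tc) => z vz pz.
  by case/existsP: nbb; exists z; rewrite vz.
case/existsP=> w2 /andP[b2 b2'].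
have [//|[u [rvu bpu nru bvpu [rppu nbpu]]]] :=
  coverable_or_obstruction tc r1 r1' b2 b2'.
have := coverable_or_obstruction (v := p v) tc r1'.
rewrite (partnerK tc) => /(_ _ r1 b2' b2).
case=> [//|[x [rpx bvx nrx bppx _]]].
have u_blue z : r (p v) z -> z <> p u -> b u z.
  move=> rpz zpu; case: (red_or_blue tc (x := u) (y := z)) => //.
    by move=> E; subst z; case: (not_red_blue tc rpz).
  by move/nru: rpz.
have pu_red z : b (p v) z -> z <> u -> r (p u) z.
  move=> bpz zu; case: (red_or_blue tc (x := p u) (y := z)) => //.
  - by move=> E; subst z; case: (not_red_blue tc rppu).
  - by rewrite (partnerK tc).
  - by move/nbpu: bpz.
case: (boolP [exists t, [&& r v t, b (p v) t & t != u]]) => [|only_u]; last first.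
  exists (closed_nbhd b u), (closed_nbhd b v), false, false.
  split; last 2 first; try exact: pairwise_closed_nbhd (blue_sym tc).
  move=> z; rewrite !inE.
  case: (eqVneq z u) => [|zu]; first by left.
  case: (eqVneq z v) => [|/eqP zv]; first by right.
  case: (eqVneq z (p v)) => [->|/eqP zpv].
    by left; rewrite (blue_sym tc) bpu orbT.
  have [rvz|->] := red_or_blue tc (not_eq_sym zv) zpv; last by right.
  (* As [z] is red to [v] and is not [u], being blue to [p v] would contradict [only_u]; so [z] is
     red to [p v]. *)
  left; apply: u_blue; last first.
    by move=> E; subst z; case: (not_red_blue tc rvz).
  case: (red_or_blue tc (x := p v) (y := z)) => //.
  - exact: not_eq_sym.
  - by rewrite (partnerK tc).
  - by move=> bpz; case/existsP: only_u; exists z; rewrite rvz bpz.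
case/existsP=> t /and3P[rvt bpt /eqP tu].
(* [t] is blue to [p v], hence red to [p u]; but [t] is red to [v], and no such vertex is red to
   [x]. *)
have xpu : x <> p u.
  by move=> E; move: (pu_red t bpt tu); rewrite -E; apply: nrx.
have x_blue z : r v z -> z <> p x -> b x z.
  move=> rvz zpx; case: (red_or_blue tc (x := x) (y := z)) => //.
    by move=> E; subst z; case: (not_red_blue tc rvz).
  by move/nrx: rvz.
pose A := v |: [set z | [|| z == u, z == p v | r (p v) z && (z != p u)]].
exists A, (closed_nbhd r (p u)), false, true; split.
- move=> z; rewrite !inE.
  case: (eqVneq z v) => [|/eqP zv]; first by left.
  case: (eqVneq z u) => [|/eqP zu]; first by left.
  case: (eqVneq z (p v)) => [|/eqP zpv]; first by left.
  case: (eqVneq z (p u)) => [|zpu]; first by right.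
  case: (red_or_blue tc (x := p v) (y := z)) => [|||bpz].
  + exact: not_eq_sym.
  + by rewrite (partnerK tc).
  + by move->; left.
  + by right; apply: pu_red.
- apply: pairwise_within2U1 (blue_sym tc) _ _.
    apply: (pairwise_within2S _ (pairwise_closed_nbhd (x := u) (blue_sym tc))).
    apply/subsetP=> z; rewrite !inE => /or3P[->//|/eqP->|/andP[rpz /eqP zpu]].
      by rewrite (blue_sym tc) bpu orbT.
    by rewrite u_blue ?orbT.
  (* Blue routes from [v]: to [u] through [x], to [p v] through [w2], and to a red neighbour of
     [p v] directly or, if it is red to [v], through [x]. The latter is never [p x], which is blue
     to [p v]. *)
  move=> z; rewrite inE => /or3P[/eqP->|/eqP->|/andP[rpz _]].
  + apply: (within2_trans bvx); apply: x_blue => // E.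
    by apply: xpu; rewrite E (partnerK tc).
  + by apply: (within2_trans b2); rewrite (blue_sym tc).
  + case: (eqVneq v z) => [->|/eqP vz]; first exact: within2_refl.
    case: (red_or_blue tc vz) => [E|rvz|/within2_edge//].
    * by move: rpz; rewrite E (red_irr tc).
    * apply: (within2_trans bvx); apply: x_blue => // E.
      by subst z; case: (not_red_blue tc rpz).
- exact: pairwise_closed_nbhd (red_sym tc).
Qed.

(** * From relations back to edge sets *)

Lemma within2_distance_le (V : finType) (E : {set {set V}}) x y :
  irreflexive (adjacent E) -> within2 (adjacent E) x y -> distance_le E 2 x y.
Proof.
move=> irr; case: (eqVneq x y) => [->|xy]; first by exists [::].
rewrite /within2 (negbTE xy) /= => /orP[axy|/existsP[z /andP[xz zy]]].
  by exists [:: y]; rewrite /= axy inE xy.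
exists [:: z; y]; split; rewrite //= ?xz ?zy // !inE (negbTE xy) orbF andbT.
(* Irreflexivity separates the midpoint [z] from both ends, so the walk is a simple path. *)
by apply/andP; split; apply/eqP=> E'; subst z; rewrite irr in xz zy.
Qed.

(** Covering gives every vertex a matching edge, and disjointness makes its other end unique.
    Uniqueness also makes the chosen map an involution. *)
Lemma perfect_matching_partner (V : finType) (M : {set {set V}}) :
  perfect_matching (complete_graph V) M ->
  exists2 p : V -> V, involutive p &
    forall x y, x <> y -> ([set x; y] \in M) -> y = p x.
Proof.
case=> /subsetP sM /and3P[/eqP cov /trivIsetP triv _].
have same x y z : y != x -> z != x ->
    [set x; y] \in M -> [set x; z] \in M -> y = z.
  move=> yx zx yM zM; have [eqs|neq] := eqVneq [set x; y] [set x; z].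
    have : y \in [set x; z] by rewrite -eqs set22.
    by rewrite !inE (negbTE yx) => /eqP.
  have /pred0P/(_ x) := triv _ _ yM zM neq.
  by rewrite /= !set21.
have ex x : exists y, (y != x) && ([set x; y] \in M).
  have : x \in cover M by rewrite cov inE.
  case/bigcupP=> f fM xf; have := sM f fM; rewrite inE => /cards2P[a [d [ad Ef]]].
  move: xf; rewrite Ef in fM *; rewrite !inE => /orP[]/eqP->.
    by exists d; rewrite eq_sym ad.
  by exists a; rewrite ad setUC.
exists (fun x => xchoose (ex x)) => [x|x y xy xyM].
- have /andP[yx yM] := xchooseP (ex x); set y := xchoose (ex x) in yx yM *.
  have /andP[zy zM] := xchooseP (ex y).
  by apply: (same y) => //; rewrite 1?eq_sym // setUC.
- have /andP[zx zM] := xchooseP (ex x).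
  by apply: (same x) => //; rewrite eq_sym; apply/eqP.
Qed.

Lemma adjacent_sym (V : finType) (E : {set {set V}}) : symmetric (adjacent E).
Proof. by move=> x y; rewrite /adjacent setUC. Qed.

Theorem theorem3 (m : nat) (hm : 1 <= m) (V : finType) (E : {set {set V}})
    (hE : cocktail_party m E) (c : {set V} -> 'I_2) :
  exists (A B : {set V}) (i j : 'I_2),
    [/\ A :|: B = [set: V],
        two_reachable (color_subgraph E c i) A
      & two_reachable (color_subgraph E c j) B].
Proof.
case: hE => cardV [M [/perfect_matching_partner[p pK pM] defE]].
have /card_gt0P[v _] : 0 < #|V| by rewrite cardV muln_gt0.
have irr i : irreflexive (adjacent (color_subgraph E c i)).
  by move=> x; rewrite /adjacent !inE defE !inE setUid cards1 andbF.
(* Colour 0 plays the role of red and colour 1 that of blue. *)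
have tc : two_coloring p (adjacent (color_subgraph E c ord0))
                         (adjacent (color_subgraph E c ord_max)).
  split=> //; try exact: adjacent_sym.
    move=> x y; rewrite /adjacent !inE => /andP[_ /eqP->] /andP[_ /eqP].
    by move/(congr1 val).
  move=> x y xy ypx; rewrite /adjacent !inE.
  have -> : [set x; y] \in E.
    rewrite defE !inE cards2; move/eqP: (xy) => ->; rewrite andbT.
    by apply/negP => /(pM x y xy).
  by case: (c _) => [[|[|k]] lk] //; [left | right]; apply/eqP/val_inj.
have [A [B [s [t [cov HA HB]]]]] := two_coloring_coverable v tc.
have reach (s' : bool) X :
    pairwise_within2 (if s' then adjacent (color_subgraph E c ord0)
                      else adjacent (color_subgraph E c ord_max)) X ->
    two_reachable (color_subgraph E c (if s' then ord0 else ord_max)) X.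
  by case: s' => HX x y xX yX; apply: within2_distance_le => //; apply: HX.
exists A, B, (if s then ord0 else ord_max), (if t then ord0 else ord_max).
split; [|exact: reach|exact: reach].
by apply/setP=> z; rewrite !inE; apply/orP/cov.
Qed.
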